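(* Let $\mathbf s=(s_i)_{i=0}^{n-1}$ define the $n\times n$ Vandermonde matrix $V=V_{\mathbf s}=(s_i^j)_{i,j=0}^{n-1}$. Write $s_+=\max_{i}|s_i|$ and $\bar\epsilon=(s_++1)\epsilon$, where $\log(1/\epsilon)=O(\log n)$, and let $\rho=O(\log(n/\epsilon))$. Then $\alpha_{\bar\epsilon}(V)+\alpha_{\bar\epsilon}(V^T)=O(n\rho\log n)$ and $\beta_{\bar\epsilon}(V)+\beta_{\bar\epsilon}(V^T)=O(n\rho^2\log n)$.
   Context: For a matrix $M$, $|M|=\max_{i,j}|m_{i,j}|$. $\alpha(M)$ (resp. $\beta(M)$) denotes the arithmetic cost (number of flops) of computing $M\mathbf u$ (resp. $M^{-1}\mathbf u$), maximized over all unit vectors $\mathbf u$ and minimized over all algorithms; $\alpha_\epsilon(M)=\min_{|E|\le\epsilon}\alpha(M+E)$ and $\beta_\epsilon(M)=\min_{|E|\le\epsilon}\beta(M+E)$. *)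

(* Defs.v *)
From HB Require Import structures.
From mathcomp Require Import all_boot all_order all_algebra.
From mathcomp Require Import all_classical all_reals.
From mathcomp Require Import ereal exp.
From mathcomp Require Import complex.
Set Implicit Arguments.
Unset Strict Implicit.
Unset Printing Implicit Defensive.
Import Order.TTheory GRing.Theory Num.Theory.
Local Open Scope ring_scope.

(** * Straight-line arithmetic programs over a field K.
    Registers are numbered 0,1,2,... in order of creation; each instruction
    creates one new register. Operands must refer to previously created
    registers. Reading an input or a constant is free; each of the four
    arithmetic operations is one flop. Division by zero makes the run fail. *)
Inductive instr (K : Type) : Type :=
  | Inp of nat
  | Cst of K
  | Add of nat & nat
  | Sub of nat & nat
  | Mul of nat & nat
  | Div of nat & nat.

Arguments Inp {K}.
Arguments Add {K}.
Arguments Sub {K}.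
Arguments Mul {K}.
Arguments Div {K}.

Record slp (K : Type) := SLP { slp_code : seq (instr K); slp_out : seq nat }.

Definition is_flop (K : Type) (i : instr K) : bool :=
  match i with Inp _ | Cst _ => false | _ => true end.

Definition slp_cost (K : Type) (P : slp K) : nat := count (@is_flop K) (slp_code P).

Section Eval.
Variable K : fieldType.

Definition reg (regs : seq K) (a : nat) : option K :=
  if (a < size regs)%N then Some (nth 0 regs a) else None.

Definition step (n : nat) (u : 'cV[K]_n) (regs : seq K) (i : instr K) : option K :=
  match i with
  | Inp k => omap (fun j : 'I_n => u j 0) (insub k)
  | Cst c => Some c
  | Add a b => obind (fun x => omap (fun y => x + y) (reg regs b)) (reg regs a)
  | Sub a b => obind (fun x => omap (fun y => x - y) (reg regs b)) (reg regs a)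
  | Mul a b => obind (fun x => omap (fun y => x * y) (reg regs b)) (reg regs a)
  | Div a b => obind (fun x => obind (fun y => if y == 0 then None else Some (x / y))
                                     (reg regs b)) (reg regs a)
  end.

Fixpoint run (n : nat) (u : 'cV[K]_n) (regs : seq K) (code : seq (instr K))
  : option (seq K) :=
  match code with
  | [::] => Some regs
  | i :: code' => match step u regs i with
                  | Some x => run u (rcons regs x) code'
                  | None => None
                  end
  end.

Definition slp_eval (n : nat) (P : slp K) (u : 'cV[K]_n) : option (seq K) :=
  obind (fun regs =>
    if all (fun a => (a < size regs)%N) (slp_out P)
    then Some [seq nth 0 regs a | a <- slp_out P] else None)
    (run u [::] (slp_code P)).
End Eval.

Section Costs.
Variable R : realType.
Local Notation C := R[i].

Definition mx_maxabs_le (m n : nat) (M : 'M[C]_(m, n)) (e : R) : Prop :=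
  forall i j, `|M i j| <= (e%:C)%C.

Definition unit_vec (n : nat) (u : 'cV[C]_n) : Prop :=
  \sum_(i < n) `|u i 0| ^+ 2 = 1.

Definition slp_computes (n : nat) (P : slp C) (f : 'cV[C]_n -> 'cV[C]_n) : Prop :=
  forall u : 'cV[C]_n, unit_vec u ->
    slp_eval P u = Some [seq f u i 0 | i <- enum 'I_n].

Local Open Scope ereal_scope.

Definition alpha (n : nat) (M : 'M[C]_n) : \bar R :=
  ereal_inf [set ((slp_cost P)%:R)%:E | P in [set P : slp C | slp_computes P (fun u => M *m u)]].

(** beta(M): minimal number of flops of a program computing M^{-1} u
    (+oo if M is singular: no such program is admitted). *)
Definition beta (n : nat) (M : 'M[C]_n) : \bar R :=
  ereal_inf [set ((slp_cost P)%:R)%:E | P in [set P : slp C |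
     M \in unitmx /\ slp_computes P (fun u => invmx M *m u)]].

Definition alpha_eps (n : nat) (M : 'M[C]_n) (e : R) : \bar R :=
  ereal_inf [set alpha (M + E) | E in [set E : 'M[C]_n | mx_maxabs_le E e]].

Definition beta_eps (n : nat) (M : 'M[C]_n) (e : R) : \bar R :=
  ereal_inf [set beta (M + E) | E in [set E : 'M[C]_n | mx_maxabs_le E e]].

End Costs.

Definition vandermonde (K : pzRingType) (n : nat) (s : 'I_n -> K) : 'M[K]_n :=
  \matrix_(i < n, j < n) s i ^+ j.

Definition s_plus (R : realType) (n : nat) (s : 'I_n -> R[i]) : R :=
  \big[Num.max/0]_(i < n) complex.Re `|s i|.

(* Main.v *)
(* Since [rho >= ln n], exact algorithms with [O(n log^2 n)] operations suffice;
   the perturbation is only used to make the nodes distinct. For distinct nodes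
   the inverse of [V] is [U D], where [D] is diagonal and column [j] of [U] holds
   the coefficients of [\prod_(l != j) ('X - s l)]: [U] is computed by divide and
   conquer, each merge being a multiplication by fixed polynomials, that is by
   Toeplitz matrices. Moreover [V^T = (V^T V) V^-1], and [V^T V] is a Hankel matrix.
   Hankel and Toeplitz matrices are submatrices of some [W^T D W], with [W] the
   Vandermonde matrix of the roots of [x ^ (2 ^ k) = 1], which the FFT recursion
   applies in [O(k 2^k)]. The cost model is invariant under transposition, which
   gives [V] and the inverse of [V^T]. *)
Require Import Defs.
From HB Require Import structures.
From mathcomp Require Import all_boot all_order all_algebra.
From mathcomp Require Import all_classical all_reals.
From mathcomp Require Import ereal exp.
From mathcomp Require Import complex.
From mathcomp Require Import zify ring lra.
Set Implicit Arguments.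
Unset Strict Implicit.
Unset Printing Implicit Defensive.
Import Order.TTheory GRing.Theory Num.Theory.
Local Open Scope ring_scope.

(** * A cost calculus for matrices, closed under transposition *)

(* Factorisations of a matrix into cheap pieces. A column block costs nothing to
   assemble, but it is charged [p] operations so that the rules are invariant
   under transposition. *)
Inductive lincost (F : fieldType) : forall m n, 'M[F]_(m, n) -> nat -> Prop :=
  | LC_diag n (d : 'rV[F]_n) : lincost (diag_mx d) n
  | LC_mul m n p (A : 'M[F]_(m, n)) (B : 'M[F]_(n, p)) a b :
      lincost A a -> lincost B b -> lincost (A *m B) (a + b)
  | LC_row m n p (A : 'M[F]_(m, n)) (B : 'M[F]_(m, p)) a b :
      lincost A a -> lincost B b ->
      lincost (row_mx A B) (a + b + m)
  | LC_col m n p (A : 'M[F]_(m, p)) (B : 'M[F]_(n, p)) a b :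
      lincost A a -> lincost B b ->
      lincost (col_mx A B) (a + b + p)
  | LC_sub m n m' n' (f : 'I_m' -> 'I_m) (g : 'I_n' -> 'I_n) (A : 'M[F]_(m, n)) a :
      injective f -> injective g ->
      lincost A a -> lincost (mxsub f g A) a
  | LC_weak m n (A : 'M[F]_(m, n)) a b :
      lincost A a -> (a <= b)%N -> lincost A b.

(** A form of Tellegen's principle: transposition exchanges [LC_row] with [LC_col], reverses
    products and maps every other rule to itself, always with the same charge. *)
Lemma lincost_tr (F : fieldType) (m n : nat) (A : 'M[F]_(m, n)) (c : nat) :
  lincost A c -> lincost A^T c.
Proof.
elim=> {m n A c}.
- by move=> n d; rewrite tr_diag_mx; apply: LC_diag.
- by move=> m n p A B a b _ HA _ HB; rewrite trmx_mul addnC; apply: LC_mul.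
- by move=> m n p A B a b _ HA _ HB; rewrite tr_row_mx; apply: LC_col.
- by move=> m n p A B a b _ HA _ HB; rewrite tr_col_mx; apply: LC_row.
- by move=> m n m' n' f g A a fI gI _ HA; rewrite trmx_mxsub; apply: LC_sub.
- by move=> m n A a b _ HA ab; apply: LC_weak ab.
Qed.

(** * Compiling factorisations into straight-line programs *)

Section Soundness.
Variables (F : fieldType) (p : nat) (u : 'cV[F]_p).

Lemma run_cat (regs : seq F) (c1 c2 : seq (instr F)) :
  run u regs (c1 ++ c2) = obind (fun r => run u r c2) (run u regs c1).
Proof. by elim: c1 regs => //= i c1 IH regs; case: step. Qed.

(** Quantifying over [r] says that the value of each instruction does not depend on the registers
    that the batch itself appends, so running the batch amounts to a [map]. *)
Lemma run_batch (v : instr F -> F) (regs : seq F) (code : seq (instr F)) :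
  (forall i (r : seq F), List.In i code -> step u (regs ++ r) i = Some (v i)) ->
  run u regs code = Some (regs ++ map v code).
Proof.
elim: code regs => [|i code IH] regs H /=; first by rewrite cats0.
have := H i [::] (or_introl erefl); rewrite cats0 => ->.
rewrite IH -?cat_rcons // => j r jc.
by rewrite cat_rcons; apply: H; right.
Qed.

Lemma reg_cat (regs r : seq F) (a : nat) : (a < size regs)%N ->
  reg (regs ++ r) a = Some (nth 0 regs a).
Proof. by move=> h; rewrite /reg size_cat ltn_addr // nth_cat h. Qed.

End Soundness.

Lemma count_map0 (K : Type) (T : Type) (f : T -> instr K) (s : seq T) :
  (forall x, is_flop (f x) = false) -> count (@is_flop K) (map f s) = 0%N.
Proof. by move=> H; elim: s => //= x s ->; rewrite H. Qed.

Lemma In_map_enum (T : Type) (n : nat) (f : 'I_n -> T) (x : T) :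
  List.In x [seq f i | i <- enum 'I_n] -> exists i, x = f i.
Proof. by elim: (enum _) => //= i s IH [<-|/IH //]; exists i. Qed.

(* The program is relocatable: it reads its arguments from registers [xs]
   of any register file of size [sz], and appends its own registers. *)
Lemma lincost_sound (F : fieldType) (m n : nat) (A : 'M[F]_(m, n)) (c : nat) :
  lincost A c ->
  forall (sz : nat) (xs : 'I_n -> nat), (forall j, (xs j < sz)%N) ->
  exists (code : seq (instr F)) (ys : 'I_m -> nat),
  [/\ (count (@is_flop F) code <= c)%N,
      forall i, (ys i < sz + size code)%N &
      forall (p : nat) (u : 'cV[F]_p) (regs : seq F), size regs = sz ->
      exists r : seq F, [/\ run u regs code = Some (regs ++ r),
        size r = size code &
        forall i, nth 0 (regs ++ r) (ys i)
                  = \sum_j A i j * nth 0 regs (xs j)]].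
Proof.
elim=> {m n A c}.
- move=> n d sz xs xsP.
  pose c1 := [seq Cst (d 0 i) | i <- enum 'I_n].
  pose mu (i : 'I_n) : instr F := Mul (sz + i) (xs i).
  have s1 : size c1 = n by rewrite size_map size_enum_ord.
  exists (c1 ++ [seq mu i | i <- enum 'I_n]), (fun i => (sz + n + i)%N).
  split.
  + by rewrite count_cat /c1 (count_map0 (f := fun i => Cst (d 0 i))) // add0n (leq_trans (count_size _ _)) // size_map size_enum_ord.
  + by move=> i; rewrite size_cat s1 size_map size_enum_ord addnA ltn_add2l.
  move=> p u regs sr.
  pose v1 (i : instr F) := if i is Cst x then x else 0.
  have R1 : run u regs c1 = Some (regs ++ map v1 c1).
    by apply: run_batch => _ r /(@In_map_enum (instr F)) [j ->].
  set regs1 := regs ++ map v1 c1 in R1.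
  have nthc (j : 'I_n) : nth 0 regs1 (sz + j) = d 0 j.
    rewrite nth_cat -sr ltnNge leq_addr /= addKn (nth_map (Cst 0)) ?s1 //.
    by rewrite (nth_map j) ?size_enum_ord //= nth_ord_enum.
  have sr1 : size regs1 = (sz + n)%N by rewrite size_cat sr size_map s1.
  have nthx (j : 'I_n) : nth 0 regs1 (xs j) = nth 0 regs (xs j).
    by rewrite nth_cat sr xsP.
  pose v2 (i : instr F) := if i is Mul a b then nth 0 regs1 a * nth 0 regs1 b else 0.
  have R2 : run u regs1 [seq mu i | i <- enum 'I_n]
      = Some (regs1 ++ map v2 [seq mu i | i <- enum 'I_n]).
    apply: run_batch => _ r /(@In_map_enum (instr F)) [j ->] /=.
    rewrite !reg_cat ?sr1 ?ltn_add2l //=.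
    by rewrite (leq_trans (xsP j)) // leq_addr.
  exists (map v1 c1 ++ map v2 [seq mu i | i <- enum 'I_n]); split.
  + by rewrite run_cat R1 /= R2 -catA.
  + by rewrite !size_cat !size_map.
  move=> i; rewrite catA -/regs1 nth_cat sr1 ltnNge leq_addr /= addKn.
  rewrite -map_comp (nth_map i) ?size_enum_ord // nth_ord_enum /= nthc nthx.
  rewrite (bigD1 i) //= mxE eqxx mulr1n big1 ?addr0 // => j ji.
  by rewrite mxE eq_sym (negbTE ji) mulr0n mul0r.
- move=> m n k A B a b _ HA _ HB sz xs xsP.
  have [cB [zs [cB1 zsP RB]]] := HB sz xs xsP.
  (* The output registers of the code for [B] are the arguments of the code for [A]. *)
  have [cA [ys [cA1 ysP RA]]] := HA _ zs zsP.
  exists (cB ++ cA), ys; split.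
  + by rewrite count_cat addnC leq_add.
  + by move=> i; rewrite size_cat addnA.
  move=> p u regs sr.
  have [rB [rB1 rB2 rB3]] := RB p u regs sr.
  have [|rA [rA1 rA2 rA3]] := RA p u (regs ++ rB); first by rewrite size_cat sr rB2.
  exists (rB ++ rA); split; first by rewrite run_cat rB1 /= rA1 catA.
    by rewrite !size_cat rA2 rB2.
  move=> i; rewrite catA rA3.
  under eq_bigr do rewrite rB3 big_distrr /=.
  rewrite exchange_big /=; apply: eq_bigr => j _.
  by rewrite mxE big_distrl /=; apply: eq_bigr => l _; rewrite mulrA.
- move=> m n k A B a b _ HA _ HB sz xs xsP.
  have [cA [ys [cA1 ysP RA]]] := HA sz (fun j => xs (lshift _ j)) (fun j => xsP _).
  have [|cB [zs [cB1 zsP RB]]] := HB (sz + size cA)%N (fun j => xs (rshift _ j)).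
    by move=> j; rewrite (leq_trans (xsP _)) // leq_addr.
  pose ad (i : 'I_m) : instr F := Add (ys i) (zs i).
  exists (cA ++ cB ++ [seq ad i | i <- enum 'I_m]),
    (fun i => (sz + size cA + size cB + i)%N); split.
  + rewrite !count_cat addnA leq_add ?leq_add //.
    by rewrite (leq_trans (count_size _ _)) // size_map size_enum_ord.
  + by move=> i; rewrite !size_cat size_map size_enum_ord !addnA ltn_add2l.
  move=> p u regs sr.
  have [rA [rA1 rA2 rA3]] := RA p u regs sr.
  have sA : size (regs ++ rA) = (sz + size cA)%N by rewrite size_cat sr rA2.
  have [rB [rB1 rB2 rB3]] := RB p u (regs ++ rA) sA.
  pose regs1 := (regs ++ rA) ++ rB.
  have sr1 : size regs1 = (sz + size cA + size cB)%N by rewrite size_cat sA rB2.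
  pose v2 (i : instr F) := if i is Add a b then nth 0 regs1 a + nth 0 regs1 b else 0.
  have R2 : run u regs1 [seq ad i | i <- enum 'I_m]
      = Some (regs1 ++ map v2 [seq ad i | i <- enum 'I_m]).
    apply: run_batch => _ r /(@In_map_enum (instr F)) [j ->] /=.
    rewrite !reg_cat ?sr1 //=.
    by rewrite (leq_trans (ysP j)) // leq_addr.
  exists (rA ++ rB ++ map v2 [seq ad i | i <- enum 'I_m]); split.
  + by rewrite run_cat rA1 /= run_cat rB1 /= R2 /regs1 -!catA.
  + by rewrite !size_cat rA2 rB2 !size_map.
  move=> i; rewrite !catA -/regs1 nth_cat sr1 ltnNge leq_addr /= addKn.
  rewrite -map_comp (nth_map i) ?size_enum_ord // nth_ord_enum /=.
  rewrite rB3 nth_cat sA ysP rA3 big_split_ord /=; congr (_ + _).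
    by apply: eq_bigr => j _; rewrite row_mxEl.
  by apply: eq_bigr => j _; rewrite row_mxEr nth_cat sr xsP.
- move=> m n k A B a b _ HA _ HB sz xs xsP.
  have [cA [ys [cA1 ysP RA]]] := HA sz xs xsP.
  have [|cB [zs [cB1 zsP RB]]] := HB (sz + size cA)%N xs.
    by move=> j; rewrite (leq_trans (xsP _)) // leq_addr.
  exists (cA ++ cB), (fun i => match fintype.split i with inl j => ys j | inr j => zs j end).
  split.
  + by rewrite count_cat (leq_trans (leq_add cA1 cB1)) // leq_addr.
  + move=> i; rewrite size_cat addnA; case: fintype.splitP => j _ //.
    by rewrite (leq_trans (ysP j)) // leq_addr.
  move=> p u regs sr.
  have [rA [rA1 rA2 rA3]] := RA p u regs sr.
  have sA : size (regs ++ rA) = (sz + size cA)%N by rewrite size_cat sr rA2.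
  have [rB [rB1 rB2 rB3]] := RB p u (regs ++ rA) sA.
  exists (rA ++ rB); split; first by rewrite run_cat rA1 /= rB1 catA.
    by rewrite !size_cat rA2 rB2.
  move=> i; rewrite catA; under eq_bigr do rewrite mxE.
  case: (fintype.split i) => j; first by rewrite nth_cat sA ysP rA3.
  by rewrite rB3; apply: eq_bigr => l _; rewrite nth_cat sr xsP.
- move=> m n m' n' f g A a fI gI _ HA sz xs xsP.
  (* A column outside the image of [g] must receive a zero argument: it is read from register [sz],
     filled by a free [Cst 0] placed before the code. *)
  pose xs' (j : 'I_n) := if [pick l | g l == j] is Some l then xs l else sz.
  have xs'g l : xs' (g l) = xs l.
    by rewrite /xs'; case: pickP => [k /eqP /gI -> //|/(_ l)]; rewrite eqxx.
  have [|cA [ys [cA1 ysP RA]]] := HA sz.+1 xs'.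
    by move=> j; rewrite /xs'; case: pickP => // l _; rewrite ltnW // ltnS xsP.
  exists (Cst 0 :: cA), (ys \o f); split=> //=.
    by move=> i; rewrite addnS -addSn.
  move=> p u regs sr.
  have [|r [r1 r2 r3]] := RA p u (rcons regs 0); first by rewrite size_rcons sr.
  exists (0 :: r); split; rewrite /= -?cat_rcons ?r2 // => i.
  (* The terms outside the image of [g] vanish; the others are reindexed along [g]. *)
  rewrite r3 (bigID (mem (codom g))) /= addrC big1 ?add0r; last first.
    move=> j jg; rewrite /xs'; case: pickP => [l /eqP gl|_].
      by rewrite -gl codom_f in jg.
    by rewrite nth_rcons sr ltnn eqxx mulr0.
  have gK l : [pick k | g k == g l] = Some l.
    by case: pickP => [k /eqP /gI -> //|/(_ l)]; rewrite eqxx.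
  rewrite (reindex_omap g (fun j => [pick l | g l == j])) /=; last first.
    by move=> _ /codomP [l ->]; rewrite gK.
  apply: eq_big => [l|l _]; first by rewrite codom_f gK eqxx.
  by rewrite xs'g nth_rcons sr xsP mxE.
- move=> m n A a b _ HA ab sz xs xsP.
  have [code [ys [h1 h2 h3]]] := HA sz xs xsP.
  by exists code, ys; split=> //; apply: leq_trans ab.
Qed.

Lemma lincost_scalar (F : fieldType) (n : nat) (a : F) : lincost (a%:M : 'M[F]_n) n.
Proof. by rewrite -diag_const_mx; apply: LC_diag. Qed.

(** * FFT on Vandermonde matrices, and Lagrange inversion *)

Definition hankel (F : fieldType) (h : nat -> F) (m n : nat) : 'M[F]_(m, n) :=
  \matrix_(i < m, j < n) h (i + j)%N.

(** The numerator of the Lagrange basis polynomial at the node [s j]. *)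
Definition excl_poly (F : fieldType) (n : nat) (s : 'I_n -> F) (j : 'I_n) : {poly F} :=
  \prod_(l | l != j) ('X - (s l)%:P).

Definition excl (F : fieldType) (n : nat) (s : 'I_n -> F) : 'M[F]_n :=
  \matrix_(i, j) (excl_poly s j)`_i.

(* The nodes of the first half satisfy [x ^ m = d], those of the second half
   [x ^ m = - d], so that the two halves only see the polynomial of size [m + m]
   reduced modulo ['X^m - d] and ['X^m + d]. *)
Lemma fft_step (F : fieldType) (m : nat) (d : F) (t1 t2 : 'I_m -> F) :
  (forall i, t1 i ^+ m = d) -> (forall i, t2 i ^+ m = - d) ->
  vandermonde (fun i : 'I_(m + m) =>
    match fintype.split i with inl j => t1 j | inr j => t2 j end)
  = col_mx (vandermonde t1 *m row_mx 1%:M d%:M)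
           (vandermonde t2 *m row_mx 1%:M (- d)%:M).
Proof.
move=> T1 T2; rewrite !mul_mx_row !mulmx1 !mul_mx_scalar.
apply/matrixP => i j; rewrite !mxE.
case: (fintype.split i) => k; rewrite !mxE; case: fintype.splitP => l ->;
  by rewrite !mxE // exprD ?T1 ?T2.
Qed.

(** A general [c] is what makes the induction work: the roots of [x ^ (2 ^ k.+1) = c] split into
    those of [x ^ (2 ^ k) = d] and of [x ^ (2 ^ k) = - d], with [d] a square root of [c]. *)
Lemma fft (C : numClosedFieldType) (k : nat) (c : C) : c != 0 ->
  exists t : 'I_(2 ^ k) -> C, [/\ injective t, forall i, t i ^+ (2 ^ k) = c &
    lincost (vandermonde t) ((4 * k + 1) * 2 ^ k)].
Proof.
elim: k c => [|k IH] c c0.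
  exists (fun=> c); split=> // [i j _|]; first by rewrite !ord1.
  rewrite (_ : vandermonde _ = 1%:M); first exact: lincost_scalar.
  by apply/matrixP => i j; rewrite !mxE !ord1 expr0.
have d0 : sqrtC c != 0 by rewrite sqrtC_eq0.
have nd0 : - sqrtC c != 0 by rewrite oppr_eq0.
have [t1 [i1 T1 L1]] := IH _ d0; have [t2 [i2 T2 L2]] := IH _ nd0.
move: (LC_col (LC_mul L1 (LC_row (lincost_scalar _ 1) (lincost_scalar _ (sqrtC c))))
  (LC_mul L2 (LC_row (lincost_scalar _ 1) (lincost_scalar _ (- sqrtC c))))).
rewrite -(fft_step T1 T2) => L.
have E : (2 ^ k.+1 = 2 ^ k + 2 ^ k)%N by rewrite expnS mul2n addnn.
(* As [c] is nonzero, its two square roots differ, so no node is shared by the two halves. *)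
have sqd : sqrtC c != - sqrtC c by rewrite -addr_eq0 -mulr2n mulrn_eq0.
(* With [m = 2 ^ k] the charges add up exactly: [2 * (4 * k + 1 + 3) * m + 2 * m = (4 * k.+1 + 1) *
   (2 * m)]. *)
rewrite E; eexists; split; last by apply: LC_weak L _; lia.
- move=> i j; rewrite -[i in _ -> i = _]splitK -[j in _ -> _ = j]splitK.
  case: (fintype.split i) => a; case: (fintype.split j) => b /= ab.
  + by rewrite (i1 _ _ ab).
  + by have := T1 a; rewrite ab T2 => /eqP; rewrite eq_sym (negPf sqd).
  + by have := T2 a; rewrite ab T1 => /eqP; rewrite (negPf sqd).
  + by rewrite (i2 _ _ ab).
- move=> i; rewrite exprD; case: (fintype.split i) => a.
    by rewrite T1 -expr2 sqrtCK.
  by rewrite T2 mulrNN -expr2 sqrtCK.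
Qed.

Lemma size_excl_poly (F : fieldType) (n : nat) (s : 'I_n -> F) (j : 'I_n) :
  (size (excl_poly s j) <= n)%N.
Proof.
rewrite /excl_poly -big_filter size_prod_XsubC size_filter.
have := count_predC (fun l => l != j) (index_enum 'I_n).
have -> : size (index_enum 'I_n) = n by rewrite -[RHS]size_enum_ord enumT.
have : has (predC (fun l => l != j)) (index_enum 'I_n); last first.
  by rewrite has_count => c0 E; rewrite -[X in (_ < X)%N]E -addn1 leq_add2l.
by apply/hasP; exists j; rewrite ?mem_index_enum //= negbK.
Qed.

(** Entry [(i, j)] of the product is the value of [excl_poly s j] at [s i], which vanishes off the
    diagonal. *)
Lemma vandermonde_excl (F : fieldType) (n : nat) (s : 'I_n -> F) :
  vandermonde s *m excl s = diag_mx (\row_j (excl_poly s j).[s j]).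
Proof.
apply/matrixP => i j; rewrite !mxE.
under eq_bigr do rewrite !mxE mulrC.
rewrite -horner_coef_wide ?size_excl_poly //.
have [->|ij] := eqVneq i j; first by rewrite mulr1n.
rewrite mulr0n /excl_poly horner_prod (bigD1 i) //=.
by rewrite hornerXsubC subrr mul0r.
Qed.

Lemma vandermonde_inv (F : fieldType) (n : nat) (s : 'I_n -> F) : injective s ->
  vandermonde s *m (excl s *m diag_mx (\row_j (excl_poly s j).[s j]^-1)) = 1%:M.
Proof.
move=> sI; rewrite mulmxA vandermonde_excl mulmx_diag -diag_const_mx.
congr diag_mx; apply/rowP => j; rewrite !mxE mulfV //.
rewrite /excl_poly horner_prod prodf_seq_neq0; apply/allP => l _; apply/implyP => lj.
by rewrite hornerXsubC subr_eq0 (inj_eq sI) eq_sym.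
Qed.

(** * Hankel and Toeplitz matrices *)

(** The weights [w] solve [\sum_l w_l * t_l ^ e = h e] for all [e < 2 ^ k], which is possible
    because the nodes [t] are distinct. The size bound keeps every [i + j] in that range. *)
Lemma lincost_hankel (C : numClosedFieldType) (h : nat -> C) (m n k : nat) :
  (m + n <= 2 ^ k)%N -> lincost (hankel h m n) ((8 * k + 3) * 2 ^ k).
Proof.
move=> mn.
have [t [tI _ L]] := @fft C k 1 (oner_neq0 _).
have mN : (m <= 2 ^ k)%N by lia.
have nN : (n <= 2 ^ k)%N by lia.
have Vu : (vandermonde t)^T \in unitmx.
  by rewrite unitmx_tr; have [] := mulmx1_unit (vandermonde_inv tI).
pose w := invmx (vandermonde t)^T *m (\col_(i < 2 ^ k) h i).
suff -> : hankel h m n = mxsub (widen_ord mN) (widen_ord nN)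
    ((vandermonde t)^T *m diag_mx (\row_l w l 0)
     *m vandermonde t).
  apply: LC_sub; [by move=> ? ? /(congr1 val) /= /val_inj..|].
  apply: LC_weak (LC_mul (LC_mul (lincost_tr L) (LC_diag _)) L) _; lia.
apply/matrixP => i j.
have ijN : (i + j < 2 ^ k)%N by have := ltn_ord i; have := ltn_ord j; lia.
rewrite !mxE.
have := congr1 (fun M : 'cV_(2 ^ k) => M (Ordinal ijN) 0) (mulKVmx Vu (\col_(i < 2 ^ k) h i)).
rewrite /= [RHS]mxE /= => <-; rewrite mxE; apply: eq_bigr => l _.
by rewrite mul_mx_diag !mxE /= exprD mulrAC.
Qed.

(** The Toeplitz matrix of multiplication by [p], from polynomials with [n] coefficients to the
    first [m] coefficients of the product. *)
Definition convmx (F : fieldType) (p : {poly F}) (m n : nat) : 'M[F]_(m, n) :=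
  \matrix_(i < m, j < n) (p * 'X^j)`_i.

Lemma convmxE (F : fieldType) (p q : {poly F}) (m n : nat) (i : 'I_m) :
  (size q <= n)%N -> \sum_(j < n) convmx p m n i j * q`_j = (p * q)`_i.
Proof.
move=> qn; have {2}-> : q = \sum_(j < n) q`_j *: 'X^j.
  rewrite -poly_def; apply/polyP => j; rewrite coef_poly; case: ltnP => // nj.
  by rewrite nth_default // (leq_trans qn).
rewrite mulr_sumr coef_sum; apply: eq_bigr => j _.
by rewrite mxE -scalerAr coefZ mulrC.
Qed.

(** Reversing the columns turns Toeplitz into Hankel. The factor ['X^(n.-1)] shifts the coefficient
    index [i - j], possibly negative, to the natural number [i + (n.-1 - j)]. *)
Lemma lincost_convmx (C : numClosedFieldType) (p : {poly C}) (m n k : nat) :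
  (m + n <= 2 ^ k)%N -> lincost (convmx p m n) ((8 * k + 3) * 2 ^ k).
Proof.
move=> mn; suff -> : convmx p m n
    = mxsub id (@rev_ord n) (hankel (fun l => (p * 'X^(n.-1))`_l) m n).
  by apply: LC_sub (lincost_hankel _ mn); [exact: inj_id|exact: rev_ord_inj].
apply/matrixP => i j; rewrite !mxE !coefMXn /=.
have jn := ltn_ord j.
have -> : (i + (n - j.+1) < n.-1)%N = (i < j)%N by apply/idP/idP; lia.
by case: ltnP => // ij; congr (p`_ _); lia.
Qed.

(** * Divide and conquer for the inverse and the transpose *)

(** When [j] lies in one half of the nodes, the product over [l != j] contains all factors of the
    other half; these form a polynomial that is the same for every such [j]. *)
Lemma excl_split (F : fieldType) (a b : nat) (s : 'I_(a + b) -> F) :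
  excl s = row_mx
    (convmx (\prod_l ('X - (s (rshift a l))%:P)) (a + b) a *m excl (fun l => s (lshift b l)))
    (convmx (\prod_l ('X - (s (lshift b l))%:P)) (a + b) b *m excl (fun l => s (rshift a l))).
Proof.
apply/matrixP => i j; rewrite [RHS]mxE [LHS]mxE.
case: fintype.splitP => l jl; rewrite mxE; set P := \prod_l _.
  have -> : j = lshift b l by apply: val_inj.
  have -> : excl_poly s (lshift b l) = P * excl_poly (fun l => s (lshift b l)) l.
    rewrite mulrC /excl_poly big_split_ord /=; congr (_ * _).
    by apply: eq_bigl => k; rewrite eq_rlshift.
  rewrite -(convmxE P i (size_excl_poly _ l)).
  by apply: eq_bigr => k _; congr (_ * _); rewrite mxE.
have -> : j = rshift a l by apply: val_inj.
have -> : excl_poly s (rshift a l) = P * excl_poly (fun l => s (rshift a l)) l.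
  rewrite /excl_poly big_split_ord /=; congr (_ * _).
    by apply: eq_bigl => k; rewrite eq_lrshift.
  by apply: eq_bigl => k; rewrite eq_rshift.
rewrite -(convmxE P i (size_excl_poly _ l)).
by apply: eq_bigr => k _; congr (_ * _); rewrite mxE.
Qed.

Lemma lincost_excl (C : numClosedFieldType) (k n : nat) (s : 'I_n -> C) :
  (n <= 2 ^ k)%N -> lincost (excl s) (100 * k.+1 ^ 2 * 2 ^ k).
Proof.
elim: k n s => [|k IH] n s.
  rewrite expn0 => n1; have -> : excl s = 1%:M.
    apply/matrixP => i j; have ij : i = j by apply: val_inj; case: i j => [i ?] [j ?] /=; lia.
    have j0 : val j = 0%N by have := ltn_ord j; rewrite /=; lia.
    rewrite !mxE ij eqxx j0 /excl_poly big_pred0 ?coef1 // => l.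
    by apply/negbTE/negPn/eqP; apply: val_inj; have := ltn_ord l; rewrite /= in j0 *; lia.
  by apply: LC_weak (lincost_scalar _ 1) _; lia.
rewrite expnS => nk.
have [a [b [E ak bk]]] : exists a b, [/\ n = (a + b)%N, (a <= 2 ^ k)%N & (b <= 2 ^ k)%N].
  by exists n./2, (n - n./2)%N; split; lia.
subst n; rewrite excl_split.
(* The merges involve sizes up to [3 * 2 ^ k], rounded up to the power [2 ^ k.+2]. Their cost is
   [O(k * 2 ^ k)], absorbed by the growth of [k.+1 ^ 2] in the bound. *)
have k2 : (2 ^ k.+2 = 4 * 2 ^ k)%N by rewrite !expnS; lia.
have c1 : (a + b + a <= 2 ^ k.+2)%N by lia.
have c2 : (a + b + b <= 2 ^ k.+2)%N by lia.
apply: LC_weak (LC_row (LC_mul (lincost_convmx _ c1) (IH _ _ ak))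
  (LC_mul (lincost_convmx _ c2) (IH _ _ bk))) _.
rewrite k2; move: (2 ^ k)%N nk => N nk; nia.
Qed.

Lemma unitmx_vandermonde (F : fieldType) (n : nat) (s : 'I_n -> F) :
  injective s -> vandermonde s \in unitmx.
Proof. by move=> /vandermonde_inv /mulmx1_unit []. Qed.

Lemma lincost_invmx_vandermonde (C : numClosedFieldType) (k n : nat) (s : 'I_n -> C) :
  injective s -> (n <= 2 ^ k)%N ->
  lincost (invmx (vandermonde s)) (101 * k.+1 ^ 2 * 2 ^ k).
Proof.
move=> sI nk.
rewrite -[invmx _]mulmx1 -(vandermonde_inv sI) mulKmx ?unitmx_vandermonde //.
apply: LC_weak (LC_mul (lincost_excl _ nk) (LC_diag _)) _.
move: (2 ^ k)%N nk => N nk; nia.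
Qed.

(* [V^T = (V^T V) V^-1], and [V^T V] is the Hankel matrix of the power sums. *)
Lemma lincost_vandermonde_tr (C : numClosedFieldType) (k n : nat) (s : 'I_n -> C) :
  injective s -> (n <= 2 ^ k)%N ->
  lincost (vandermonde s)^T (123 * k.+1 ^ 2 * 2 ^ k).
Proof.
move=> sI nk; have Vu := unitmx_vandermonde sI.
rewrite -[_^T](mulmxK Vu).
have -> : (vandermonde s)^T *m vandermonde s = hankel (fun e => \sum_l s l ^+ e) n n.
  apply/matrixP => i j; rewrite !mxE; apply: eq_bigr => l _.
  by rewrite !mxE exprD.
have nn : (n + n <= 2 ^ k.+1)%N by rewrite expnS; lia.
(* The Hankel factor costs [(16 * k + 22) * 2 ^ k], at most [22 * k.+1 ^ 2 * 2 ^ k], and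
   [123 = 101 + 22]. *)
apply: LC_weak (LC_mul (lincost_hankel _ nn) (lincost_invmx_vandermonde sI nk)) _.
rewrite expnS; move: (2 ^ k)%N nk => N nk; nia.
Qed.

(** * Perturbing the nodes to make them distinct *)

Section Perturbation.
Variable R : realType.
Local Notation C := R[i].

(** Node [i] moves to [s i + i * tau]. Two distinct indices collide only when [tau] is a root of a
    nonzero polynomial of degree one, so all but finitely many [tau] separate all nodes. *)
Lemma injective_near (n : nat) (s : 'I_n -> C) (d : C) : 0 < d ->
  exists s' : 'I_n -> C, injective s' /\ forall i, `|s' i - s i| <= d.
Proof.
move=> d0.
pose q (ij : 'I_n * 'I_n) : {poly C} :=
  (s ij.1 - s ij.2)%:P + ((ij.1 : nat)%:R - (ij.2 : nat)%:R) *: 'X.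
pose P : {poly C} := \prod_(ij | ij.1 != ij.2) q ij.
have P0 : P != 0.
  apply/prodf_neq0 => -[i j] /= ij; apply/eqP => /(congr1 (fun p : {poly C} => p`_1)).
  rewrite /q coefD coefC coefZ coefX coef0 /= add0r mulr1 => /eqP.
  by rewrite subr_eq0 eqr_nat (inj_eq val_inj) (negbTE ij).
(* The factor [n.+1] keeps every shift [i * tau m] below [d]; letting [m] vary gives more candidates
   than [P] has roots. *)
pose tau (m : nat) : C := d / (n.+1 * m.+1)%:R.
have tau_inj : injective tau.
  move=> a b /(mulfI (lt0r_neq0 d0)) /invr_inj /eqP.
  by rewrite eqr_nat eqn_pmul2l // => /eqP [].
have [m Pm] : exists m, ~~ root P (tau m).
  apply: contrapT => H.
  have := max_poly_roots P0 (rs := map tau (iota 0 (size P))).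
  rewrite map_inj_uniq // iota_uniq size_map size_iota ltnn => H2.
  suff : false by []; apply: H2 => //; apply/allP => _ /mapP [m _ ->].
  by apply: contrapT => /negP nr; apply: H; exists m.
exists (fun i => s i + (i : nat)%:R * tau m); split.
  move=> i j ij; apply/eqP; apply: contraT => nij.
  case/negP: Pm; rewrite /root horner_prod (bigD1 (i, j)) //= /q /=.
  rewrite hornerD hornerC hornerZ hornerX.
  have -> : s i - s j + (i%:R - j%:R) * tau m
          = (s i + i%:R * tau m) - (s j + j%:R * tau m) by ring.
  by rewrite ij subrr mul0r.
move=> i; rewrite addrC addKr normrM normr_nat /tau.
rewrite ger0_norm; last by rewrite divr_ge0 ?ltW.
rewrite mulrCA ler_piMr ?(ltW d0) // ler_pdivrMr ?ltr0n // mul1r ler_nat.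
by have := ltn_ord i; nia.
Qed.

(** Factor out [x - y]; since [1 <= B], each of the [j] remaining terms is at most [B ^+ n], which
    makes the bound uniform in [j]. *)
Lemma norm_exprB (x y B : C) (n j : nat) : `|x| <= B -> `|y| <= B -> 1 <= B ->
  (j < n)%N -> `|x ^+ j - y ^+ j| <= `|x - y| * (n%:R * B ^+ n).
Proof.
move=> xB yB B1 jn; have B0 : 0 <= B by apply: le_trans B1.
rewrite subrXX normrM ler_wpM2l //; apply: le_trans (ler_norm_sum _ _ _) _.
apply: (@le_trans _ _ (\sum_(i < j) B ^+ n)).
  apply: ler_sum => i _; rewrite normrM !normrX.
  apply: (@le_trans _ _ (B ^+ (j.-1 - i) * B ^+ i)).
    by apply: ler_pM; rewrite ?exprn_ge0 // lerXn2r // nnegrE.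
  by rewrite -exprD ler_weXn2l //; have := ltn_ord i; lia.
rewrite sumr_const card_ord -[leLHS]mulr_natl ler_wpM2r ?exprn_ge0 //.
by rewrite ler_nat ltnW.
Qed.

Lemma vandermonde_near (n : nat) (s : 'I_n -> C) (e : R) : 0 < e ->
  exists s' : 'I_n -> C, injective s' /\
    mx_maxabs_le (vandermonde s' - vandermonde s) e.
Proof.
move=> e0; have e0C : 0 < (e%:C)%C :> C by rewrite ltcR.
(* The extra [1] lets [B] bound the perturbed nodes as well, their displacement [d] being at most
   [1]. *)
pose B : C := 1 + \sum_i `|s i|.
have B1 : 1 <= B by rewrite lerDl sumr_ge0.
have sB i : `|s i| + 1 <= B.
  by rewrite addrC lerD2l (bigD1 i) //= lerDl sumr_ge0.
have D0 : 0 <= n%:R * B ^+ n by rewrite mulr_ge0 // exprn_ge0 // (le_trans _ B1).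
set D := n%:R * B ^+ n in D0 *.
have eD : 0 < (e%:C)%C + D by rewrite ltr_wpDr.
(* This choice gives [d <= 1] and [d * D <= e] at once. *)
pose d := (e%:C)%C / ((e%:C)%C + D).
have d0 : 0 < d by rewrite divr_gt0.
have d1 : d <= 1 by rewrite ler_pdivrMr // mul1r lerDl.
have dD : d * D <= (e%:C)%C.
  rewrite /d mulrAC ler_pdivrMr // ler_wpM2l ?(ltW e0C) //.
  by rewrite lerDr (ltW e0C).
have [s' [s'I s's]] := injective_near s d0.
exists s'; split=> // i j; rewrite !mxE.
have sB' : `|s' i| <= B.
  rewrite -[s' i](subrK (s i)) (le_trans (ler_normD _ _)) // addrC.
  by rewrite (le_trans _ (sB i)) // lerD2l (le_trans (s's i)).
have sB'' : `|s i| <= B by rewrite (le_trans _ (sB i)) // lerDl.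
apply: le_trans (norm_exprB sB' sB'' B1 (ltn_ord j)) _.
by apply: le_trans dD; apply: ler_wpM2r.
Qed.

(** * From factorisations to bounds on [alpha_eps] and [beta_eps] *)

Lemma lincost_slp (n : nat) (A : 'M[C]_n) (c : nat) : lincost A c ->
  exists P : slp C, slp_computes P (fun u => A *m u) /\ (slp_cost P <= c)%N.
Proof.
move=> /lincost_sound /(_ n (@nat_of_ord n) (@ltn_ord n)) [code [ys [cc ysP H]]].
(* Free loads put the entries of [u] in registers [0] to [n - 1], where the relocatable code expects
   them. *)
pose inp := [seq (Inp (nat_of_ord i) : instr C) | i <- enum 'I_n].
exists (SLP (inp ++ code) [seq ys i | i <- enum 'I_n]); split; last first.
  by rewrite /slp_cost /= count_cat /inp (count_map0 (f := fun i : 'I_n => Inp (nat_of_ord i))).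
move=> u _; rewrite /slp_eval /= run_cat.
pose v (i : instr C) := if i is Inp k then oapp (fun j : 'I_n => u j 0) 0 (insub k) else 0.
rewrite (@run_batch C _ u v [::]) /=; last first.
  by move=> _ r /(@In_map_enum (instr C)) [j ->] /=; rewrite valK.
have si : size [seq v i | i <- inp] = n by rewrite size_map /inp size_map size_enum_ord.
have [r [-> sr ev]] := H n u _ si; rewrite /= size_cat si sr.
case: allP => [_|[]]; last by move=> _ /mapP [i _ ->].
congr Some; rewrite -map_comp; apply: eq_map => i /=.
rewrite ev mxE; apply: eq_bigr => j _; congr (_ * _).
by rewrite -map_comp (nth_map j) ?size_enum_ord //= nth_ord_enum valK.
Qed.

Lemma alpha_eps_le (n : nat) (A A' : 'M[C]_n) (e : R) (c : nat) :
  mx_maxabs_le (A' - A) e -> lincost A' c -> (alpha_eps A e <= (c%:R)%:E)%E.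
Proof.
move=> AA /lincost_slp [P [Pf Pc]]; apply: ge_ereal_inf; exists (alpha A').
  by exists (A' - A); [exact: AA | rewrite (addrC A) subrK].
apply: ge_ereal_inf; exists (((slp_cost P)%:R)%:E); first by exists P.
by rewrite lee_fin ler_nat.
Qed.

Lemma beta_eps_le (n : nat) (A A' : 'M[C]_n) (e : R) (c : nat) :
  mx_maxabs_le (A' - A) e -> A' \in unitmx -> lincost (invmx A') c ->
  (beta_eps A e <= (c%:R)%:E)%E.
Proof.
move=> AA A'u /lincost_slp [P [Pf Pc]]; apply: ge_ereal_inf; exists (beta A').
  by exists (A' - A); [exact: AA | rewrite (addrC A) subrK].
apply: ge_ereal_inf; exists (((slp_cost P)%:R)%:E); first by exists P.
by rewrite lee_fin ler_nat.
Qed.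

Lemma mx_maxabs_le_tr (m n : nat) (A : 'M[C]_(m, n)) (e : R) :
  mx_maxabs_le A e -> mx_maxabs_le A^T e.
Proof. by move=> H i j; rewrite mxE. Qed.

Lemma s_plus_ge0 (n : nat) (s : 'I_n -> C) : 0 <= s_plus s.
Proof. exact: bigmax_ge_id. Qed.

(** * Numerical bounds on logarithms *)

Lemma ln2_ge_half : 2^-1 <= ln 2 :> R.
Proof.
have := @le_ln1Dx R (- 2^-1) ltac:(lra).
rewrite (_ : 1 - 2^-1 = 2^-1 :> R); last by field.
by rewrite lnV ?posrE ?lerN2.
Qed.

(** Writing [up_log 2 n] as [k.+1], [2 ^ k < n] gives [k <= 2 * ln n], while the remaining [2] is at
    most [4 * ln n] because [ln n >= ln 2 >= 1 / 2]. *)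
Lemma up_log2_le_ln (n : nat) : (2 <= n)%N -> ((up_log 2 n).+1)%:R <= 6 * ln n%:R :> R.
Proof.
move=> n2; have /andP [lo _] := @up_log_bounds 2 n erefl n2.
have := up_log_gt0 2 n; rewrite n2 /=; case: (up_log 2 n) lo => // k /= lo _.
have l2 := ln2_ge_half.
have nL : ln 2 <= ln n%:R :> R by rewrite ler_ln ?posrE ?ltr0n ?ler_nat //; lia.
have kL : k%:R * ln 2 <= ln n%:R :> R.
  rewrite mulr_natl -lnXn // ler_ln ?posrE ?exprn_gt0 ?ltr0n //; last by lia.
  by rewrite -natrX ler_nat ltnW.
rewrite -addn2 natrD.
have : k%:R * 2^-1 <= k%:R * ln 2 :> R by rewrite ler_wpM2l.
lra.
Qed.

End Perturbation.

Theorem theorem9p4 (R : realType) :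
  forall c1 : R, 0 < c1 ->
  exists K : R, exists N : nat,
  forall (n : nat) (s : 'I_n -> R[i]) (eps : R),
    (N <= n)%N ->
    0 < eps < 1 ->
    ln (1 / eps) <= c1 * ln n%:R ->
    let rho := ln (n%:R / eps) in
    let eb := (s_plus s + 1) * eps in
    (alpha_eps (vandermonde s) eb + alpha_eps (vandermonde s)^T eb
       <= (K * n%:R * rho * ln n%:R)%:E)%E /\
    (beta_eps (vandermonde s) eb + beta_eps (vandermonde s)^T eb
       <= (K * n%:R * rho ^+ 2 * ln n%:R)%:E)%E.
Proof.
(* Two programs of cost [c] need [2 * 123 * 6 ^ 2 * 2 = 17712], rounded up to [100 * 200]; the bound
   on [beta_eps] doubles this. Taking [n >= 2] keeps [ln n] at least [1 / 2]. *)
move=> c1 _; exists (200 * 200), 2%N => n s eps n2 /andP [eps0 eps1] _ rho eb.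
have eb0 : 0 < eb by rewrite mulr_gt0 // ltr_wpDl // s_plus_ge0.
have [s' [s'I near]] := vandermonde_near s eb0.
have near_tr : mx_maxabs_le ((vandermonde s')^T - (vandermonde s)^T) eb.
  by rewrite -linearB; apply: mx_maxabs_le_tr.
set k := up_log 2 n.
have nk : (n <= 2 ^ k)%N by apply: up_logP.
pose c := (123 * k.+1 ^ 2 * 2 ^ k)%N.
have LT : lincost (vandermonde s')^T c by apply: lincost_vandermonde_tr.
(* Transposition carries the bound for the transpose to the Vandermonde matrix, and below the bound
   for the inverse to the inverse of the transpose. *)
have LV : lincost (vandermonde s') c by rewrite -[vandermonde _]trmxK; apply: lincost_tr.
have LI : lincost (invmx (vandermonde s')) c.
  apply: LC_weak (lincost_invmx_vandermonde s'I nk) _.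
  by rewrite /c -!mulnA leq_mul2r orbT.
have LIT : lincost (invmx (vandermonde s')^T) c by rewrite -trmx_inv; apply: lincost_tr.
have Vu := unitmx_vandermonde s'I.
have VTu : (vandermonde s')^T \in unitmx by rewrite unitmx_tr.
have n0 : 0 < n%:R :> R by rewrite ltr0n; lia.
have L1 : ((k.+1)%:R : R) <= 6 * ln n%:R by apply: up_log2_le_ln.
have Lh : 2^-1 <= ln n%:R :> R.
  by rewrite (le_trans (ln2_ge_half R)) // ler_ln ?posrE // ler_nat.
have Lrho : ln n%:R <= rho.
  by rewrite ler_ln ?posrE ?divr_gt0 // ler_pdivlMr // ler_piMr // ltW.
have k2 : ((2 ^ k)%:R : R) <= 2 * n%:R.
  rewrite -natrM ler_nat; have := @up_log_bounds 2 n erefl n2.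
  have := up_log_gt0 2 n; rewrite -/k n2 /=.
  by case: (k) => // m _ /= /andP [lo _]; rewrite expnS leq_mul2l ltnW.
have cb : c%:R + c%:R <= 100 * 200 * n%:R * ln n%:R ^+ 2 :> R.
  have -> : c%:R = 123 * ((k.+1)%:R ^+ 2 * (2 ^ k)%:R) :> R.
    by rewrite /c natrM natrM natrX mulrA.
  have : (k.+1)%:R ^+ 2 <= (6 * ln n%:R) ^+ 2 :> R.
    by rewrite lerXn2r ?nnegrE ?ler0n //; lra.
  move=> /ler_pM /(_ k2) => /(_ (exprn_ge0 _ (ler0n _ _)) (ler0n _ _)).
  have : 0 <= n%:R * ln n%:R ^+ 2 :> R by rewrite mulr_ge0 ?exprn_ge0; lra.
  lra.
have nL0 : 0 <= n%:R * ln n%:R :> R by rewrite mulr_ge0; lra.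
have sq : n%:R * ln n%:R * ln n%:R <= n%:R * ln n%:R * rho by rewrite ler_wpM2l.
split.
  apply: le_trans (leeD (alpha_eps_le near LV) (alpha_eps_le near_tr LT)) _.
  rewrite -EFinD lee_fin (le_trans cb) //.
  have : 0 <= n%:R * ln n%:R * ln n%:R :> R by rewrite mulr_ge0; lra.
  lra.
apply: le_trans (leeD (beta_eps_le near Vu LI) (beta_eps_le near_tr VTu LIT)) _.
rewrite -EFinD lee_fin (le_trans cb) //.
(* Since [rho >= 1 / 2], the second factor [rho] is gained at the price of doubling the constant. *)
have : n%:R * ln n%:R * rho * 2^-1 <= n%:R * ln n%:R * rho * rho.
  by rewrite ler_wpM2l ?mulr_ge0 //; lra.
lra.
Qed.
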